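(* Let $\mathbb{K}$ be an algebraically closed field of characteristic not $2$ and $d\ge0$ an integer. In each case below, let $q,s,s^*,r$ (those that occur) be nonzero scalars in $\mathbb{K}$ such that $\theta_i\ne\theta_j$, $\theta_i^*\ne\theta_j^*$ for $0\le i<j\le d$ and $\varphi_i\ne0$, $\phi_i\ne0$ for $1\le i\le d$, where $P_i=(1-q^i)(1-q^{i-d-1})$. Put $$S=sq^{d+1}+1,\quad S^*=s^*q^{d+1}+1,\quad R=r+\frac{ss^*q^{d+1}}{r},\quad Q=q^{d+1}+1,\quad K=-\frac{(q^2-1)^2}{q},\quad K^*=\frac{(q-1)^2}{q^{d+1}}.$$ Then the Leonard pair corresponding to the given parameter array satisfies the given Askey-Wilson relations. - $q$-Racah: for $\theta_i=q^{-i}+sq^{i+1}$, $\theta_i^*=q^{-i}+s^*q^{i+1}$, $\varphi_i=q^{1-2i}P_i(1-rq^i)(r-ss^*q^{d+1+i})/r$, $\phi_i=q^{1-2i}P_i(r-s^*q^i)(sq^{d+1}-rq^i)/r$: $$AW\big(q+q^{-1},0,0,sK,s^*K,-K^*(SS^*+RQ),(q+1)K^*(SR+sS^*Q),(q+1)K^*(S^*R+s^*SQ)\big).$$ - $q$-Hahn: for $\theta_i=q^{-i}$, $\theta_i^*=q^{-i}+s^*q^{i+1}$, $\varphi_i=q^{1-2i}P_i(1-rq^i)$, $\phi_i=-q^{1-i}P_i(r-s^*q^i)$: $$AW\big(q+q^{-1},0,0,0,s^*K,-K^*(S^*+rQ),(q+1)K^*r,(q+1)K^*(S^*r+s^*Q)\big).$$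 - Dual $q$-Hahn: for $\theta_i=q^{-i}+sq^{i+1}$, $\theta_i^*=q^{-i}$, $\varphi_i=q^{1-2i}P_i(1-rq^i)$, $\phi_i=q^{d+2-2i}P_i(s-rq^{i-d-1})$: $$AW\big(q+q^{-1},0,0,sK,0,-K^*(S+rQ),(q+1)K^*(Sr+sQ),(q+1)K^*r\big).$$ - $q$-Krawtchouk: for $\theta_i=q^{-i}$, $\theta_i^*=q^{-i}+s^*q^{i+1}$, $\varphi_i=q^{1-2i}P_i$, $\phi_i=s^*qP_i$: $$AW\big(q+q^{-1},0,0,0,s^*K,-K^*S^*,0,(q+1)K^*s^*Q\big).$$ - Dual $q$-Krawtchouk: for $\theta_i=q^{-i}+sq^{i+1}$, $\theta_i^*=q^{-i}$, $\varphi_i=q^{1-2i}P_i$, $\phi_i=sq^{d+2-2i}P_i$: $$AW\big(q+q^{-1},0,0,sK,0,-K^*S,(q+1)K^*sQ,0\big).$$ - Quantum $q$-Krawtchouk: for $\theta_i=q^{i+1}$, $\theta_i^*=q^{-i}$, $\varphi_i=-rq^{1-i}P_i$, $\phi_i=q^{d+2-2i}P_i(1-rq^{i-d-1})$: $$AW\big(q+q^{-1},0,0,0,0,-K^*(q^{d+1}+rQ),(q+1)(q-1)^2r,(q+1)K^*r\big).$$ - Affine $q$-Krawtchouk: for $\theta_i=q^{-i}$, $\theta_i^*=q^{-i}$, $\varphi_i=q^{1-2i}P_i(1-rq^i)$, $\phi_i=-rq^{1-i}P_i$: $$AW\big(q+q^{-1},0,0,0,0,-K^*(1+rQ),(q+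1)K^*r,(q+1)K^*r\big).$$
   Context: The displayed sequences $(\theta_0,\ldots,\theta_d;\theta_0^*,\ldots,\theta_d^*;\varphi_1,\ldots,\varphi_d;\phi_1,\ldots,\phi_d)$ are parameter arrays of diameter $d$ in Terwilliger's sense. The Leonard pair corresponding to such an array is, up to isomorphism (simultaneous conjugation), the pair $(A,A^* )$ of linear transformations of a $(d+1)$-dimensional $\mathbb{K}$-vector space whose matrices in some basis are: $A$ is lower bidiagonal with diagonal entries $\theta_0,\theta_1,\ldots,\theta_d$ and all subdiagonal entries equal to $1$; $A^*$ is upper bidiagonal with diagonal entries $\theta_0^*,\theta_1^*,\ldots,\theta_d^*$ and superdiagonal entries $\varphi_1,\ldots,\varphi_d$. A Leonard pair on $V$ is an ordered pair $(A,A^* )$ of linear transformations of $V$ such that there is a basis in which $A^*$ is diagonal and $A$ irreducible tridiagonal (tridiagonal with all super- and subdiagonal entries nonzero), and a basis in which $A$ is diagonal and $A^*$ irreducible tridiagonal. ($A^*$ is not an adjoint of $A$.) $AW(\beta,\gamma,\gamma^*,\varrho,\varrho^*,\omega,\eta,\eta^* )$ denotes the pair of Askey-Wilson relations $$A^2A^*-\beta AA^*A+A^*A^2-\gamma(AA^*+A^*A)-\varrho A^*=\gamma^*A^2+\omega A+\eta I,$$ $$A^{*2}A-\beta A^*AA^*+AA^{*2}-\gamma^*(A^*A+AA^* )-\varrho^*A=\gamma A^{*2}+\omega A^*+\eta^*I.$$ *)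

(* Defs.v *)
From mathcomp Require Import all_boot all_order all_algebra.
Set Implicit Arguments.
Unset Strict Implicit.
Unset Printing Implicit Defensive.
Import GRing.Theory.
Local Open Scope ring_scope.

(* The four sequences of a parameter array of diameter d. They are total on nat,
   but only the indices 0 <= i <= d (for theta, thetas) and 1 <= i <= d (for
   varphi, phi) are meaningful; no other index is used below. *)
Record array (F : Type) := Array {
  theta : nat -> F;
  thetas : nat -> F;
  varphi : nat -> F;
  phi : nat -> F
}.

Definition admissible (F : fieldType) (d : nat) (a : array F) : Prop :=
  (forall i j : nat, (i < j <= d)%N ->
     theta a i != theta a j /\ thetas a i != thetas a j) /\
  (forall i : nat, (1 <= i <= d)%N -> varphi a i != 0 /\ phi a i != 0).

(* The split form: theta_i on the diagonal, 1 on the subdiagonal. *)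
Definition split_mx (F : fieldType) (d : nat) (a : array F) : 'M[F]_d.+1 :=
  \matrix_(i, j) if i == j then theta a i
                 else if (i == j.+1 :> nat) then 1 else 0.

(* The entry at row i - 1, column i is varphi_i. *)
Definition split_mxs (F : fieldType) (d : nat) (a : array F) : 'M[F]_d.+1 :=
  \matrix_(i, j) if i == j then thetas a i
                 else if (j == i.+1 :> nat) then varphi a j else 0.

(* Column convention: column j of M holds the coordinates of f e_j. (mxof uses
   the transposed, row-vector convention.) *)
Definition represents (F : fieldType) (V : vectType F) (n : nat)
    (e : n.-tuple V) (f : 'End(V)) (M : 'M[F]_n) : Prop :=
  forall j : 'I_n, f e`_j = \sum_(i < n) M i j *: e`_i.

(* (A, As) is, up to isomorphism, the Leonard pair with parameter array a of
   diameter d: by Terwilliger's classification this pair is determined by the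
   existence of a basis of V in which A and As take the split form. The
   existence of e forces \dim V = d + 1. *)
Definition corresponding_pair (F : fieldType) (V : vectType F) (d : nat)
    (a : array F) (A As : 'End(V)) : Prop :=
  exists e : d.+1.-tuple V,
    [/\ basis_of fullv e,
        represents e A (split_mx d a)
      & represents e As (split_mxs d a)].

(* \o has the same precedence as +, hence the inner parentheses. *)
Definition AW (F : fieldType) (V : vectType F) (A As : 'End(V))
    (beta gamma gammas rho rhos omega eta etas : F) : Prop :=
  ((A \o A \o As) - beta *: (A \o As \o A) + (As \o A \o A)
     - gamma *: ((A \o As) + (As \o A)) - rho *: As
   = gammas *: (A \o A) + omega *: A + eta *: \1)%VF
  /\
  ((As \o As \o A) - beta *: (As \o A \o As) + (A \o As \o As)
     - gammas *: ((As \o A) + (A \o As)) - rhos *: A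
   = gamma *: (As \o As) + omega *: As + etas *: \1)%VF.

Section Families.
Variables (F : fieldType) (d : nat).
Implicit Types (q s ss r : F) (i : nat).

Definition Pq q i : F := (1 - q ^+ i) * (1 - q ^ (i%:Z - d%:Z - 1)).

Definition q_Racah q s ss r : array F := {|
  theta := fun i => q ^ (- i%:Z) + s * q ^+ i.+1;
  thetas := fun i => q ^ (- i%:Z) + ss * q ^+ i.+1;
  varphi := fun i => q ^ (1 - 2 * i%:Z) * Pq q i * (1 - r * q ^+ i)
                     * (r - s * ss * q ^+ (d + 1 + i)) / r;
  phi := fun i => q ^ (1 - 2 * i%:Z) * Pq q i * (r - ss * q ^+ i)
                  * (s * q ^+ d.+1 - r * q ^+ i) / r |}.

Definition q_Hahn q ss r : array F := {|
  theta := fun i => q ^ (- i%:Z);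
  thetas := fun i => q ^ (- i%:Z) + ss * q ^+ i.+1;
  varphi := fun i => q ^ (1 - 2 * i%:Z) * Pq q i * (1 - r * q ^+ i);
  phi := fun i => - q ^ (1 - i%:Z) * Pq q i * (r - ss * q ^+ i) |}.

Definition dual_q_Hahn q s r : array F := {|
  theta := fun i => q ^ (- i%:Z) + s * q ^+ i.+1;
  thetas := fun i => q ^ (- i%:Z);
  varphi := fun i => q ^ (1 - 2 * i%:Z) * Pq q i * (1 - r * q ^+ i);
  phi := fun i => q ^ (d%:Z + 2 - 2 * i%:Z) * Pq q i
                  * (s - r * q ^ (i%:Z - d%:Z - 1)) |}.

Definition q_Krawtchouk q ss : array F := {|
  theta := fun i => q ^ (- i%:Z);
  thetas := fun i => q ^ (- i%:Z) + ss * q ^+ i.+1;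
  varphi := fun i => q ^ (1 - 2 * i%:Z) * Pq q i;
  phi := fun i => ss * q * Pq q i |}.

Definition dual_q_Krawtchouk q s : array F := {|
  theta := fun i => q ^ (- i%:Z) + s * q ^+ i.+1;
  thetas := fun i => q ^ (- i%:Z);
  varphi := fun i => q ^ (1 - 2 * i%:Z) * Pq q i;
  phi := fun i => s * q ^ (d%:Z + 2 - 2 * i%:Z) * Pq q i |}.

Definition quantum_q_Krawtchouk q r : array F := {|
  theta := fun i => q ^+ i.+1;
  thetas := fun i => q ^ (- i%:Z);
  varphi := fun i => - r * q ^ (1 - i%:Z) * Pq q i;
  phi := fun i => q ^ (d%:Z + 2 - 2 * i%:Z) * Pq q i
                  * (1 - r * q ^ (i%:Z - d%:Z - 1)) |}.

Definition affine_q_Krawtchouk q r : array F := {|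
  theta := fun i => q ^ (- i%:Z);
  thetas := fun i => q ^ (- i%:Z);
  varphi := fun i => q ^ (1 - 2 * i%:Z) * Pq q i * (1 - r * q ^+ i);
  phi := fun i => - r * q ^ (1 - i%:Z) * Pq q i |}.

End Families.

(* Main.v *)
Require Import Defs.
From mathcomp Require Import all_boot all_order all_algebra.
From mathcomp Require Import ring.
Set Implicit Arguments.
Unset Strict Implicit.
Unset Printing Implicit Defensive.
Import GRing.Theory.
Local Open Scope ring_scope.

(* All seven arrays specialize one family: theta_i = a q^-i + b q^(i+1),
   theta*_i = aa q^-i + bb q^(i+1) and
   varphi_i = q^(1-2i) P_i (a aa - R q^i + b bb q^(d+1) q^(2i)).
   In this family varphi_0 = varphi_(d+1) = 0, so with e_i = 0 outside
   0 <= i <= d the split form reads A e_i = theta_i e_i + e_(i+1) and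
   As e_i = theta*_i e_i + varphi_i e_(i-1) without boundary cases. Applied to
   e_i, each Askey-Wilson relation then amounts to identities between rational
   functions in which q, q^i and q^(d+1) are independent variables. *)

Section SplitAction.
Variables (F : fieldType) (V : vectType F) (d : nat) (c : array F).
Variables (e : d.+1.-tuple V) (A As : 'End(V)).

(* [e`_i = 0] for [d < i], so the action formulas hold at every index. *)
Lemma split_mx_action :
  represents e A (split_mx d c) ->
  forall j, A e`_j = theta c j *: e`_j + e`_j.+1.
Proof.
move=> eA j; have [le_dj|] := leqP d.+1 j.
  by rewrite !nth_default ?size_tuple ?linear0 ?scaler0 ?addr0 // ltnW.
move=> lt_jd; rewrite (eA (Ordinal lt_jd)).
rewrite (bigD1 (Ordinal lt_jd)) //= mxE eqxx; congr (_ + _).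
(* For [j = d] the column has no subdiagonal entry, which agrees with the default value [0] at index
   [d.+1]. *)
have [lt_j1d|le_dj1] := ltnP j.+1 d.+1; last first.
  rewrite [RHS]nth_default ?size_tuple //; apply: big1 => i ne_ij.
  rewrite mxE (negPf ne_ij); case: eqP => [ij|]; rewrite ?scale0r //.
  by move: (ltn_ord i); rewrite ij ltnNge le_dj1.
rewrite (bigD1 (Ordinal lt_j1d)) /= -?val_eqE /= ?gtn_eqF //.
rewrite mxE -val_eqE /= gtn_eqF // eqxx scale1r.
rewrite big1 ?addr0 // => i /andP[ne_ij ne_ij1].
by rewrite mxE (negPf ne_ij) [_ == j.+1 :> nat](negPf ne_ij1) scale0r.
Qed.

(** The two vanishing conditions are what extends the formula past the boundary. At [j = 0] the
    truncated predecessor is again [0], and at [j = d.+1] it is [d]; both times [e] has a nonzero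
    vector there, so only the coefficient can remove the term. *)
Lemma split_mxs_action :
  represents e As (split_mxs d c) -> varphi c 0 = 0 -> varphi c d.+1 = 0 ->
  forall j, As e`_j = thetas c j *: e`_j + varphi c j *: e`_j.-1.
Proof.
move=> eAs c0 cd j; have [le_dj|] := leqP d.+1 j.
  rewrite [e`_j]nth_default ?size_tuple // linear0 scaler0 add0r.
  move: le_dj; rewrite leq_eqVlt => /predU1P[<-|]; first by rewrite cd scale0r.
  by case: j => // j lt_dj; rewrite nth_default ?size_tuple // scaler0.
move=> lt_jd; rewrite (eAs (Ordinal lt_jd)).
rewrite (bigD1 (Ordinal lt_jd)) //= mxE eqxx; congr (_ + _).
case: j lt_jd => [|j] lt_jd.
  rewrite c0 scale0r big1 // => i ne_i0.
  by rewrite mxE (negPf ne_i0) scale0r.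
rewrite (bigD1 (Ordinal (ltnW lt_jd))) /= -?val_eqE /= ?ltn_eqF //.
rewrite mxE -val_eqE /= ltn_eqF // eqxx.
rewrite big1 ?addr0 // => i /andP[ne_ij1 ne_ij].
by rewrite mxE (negPf ne_ij1) eqSS eq_sym [_ == j :> nat](negPf ne_ij) scale0r.
Qed.

(* Testing against linear forms turns identities between operators into
   identities in [F], within reach of [field]. *)
Lemma eq_on_basis (f g : 'End(V)) :
  basis_of fullv e ->
  (forall (h : {scalar V}) j, h (f e`_j) = h (g e`_j)) -> f = g.
Proof.
move=> be fg; apply/lfunP => v.
rewrite (coord_basis be (memvf v)) !linear_sum; apply: eq_bigr => i _.
rewrite !linearZ /=; congr (_ *: _).
(* The coordinate forms of [e] serve as the forms [h]. *)
rewrite [LHS](coord_basis be (memvf _)) [RHS](coord_basis be (memvf _)).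
by apply: eq_bigr => k _; rewrite fg.
Qed.

End SplitAction.

Section GeneralFamily.
Variables (F : fieldType) (d : nat) (q : F).

Lemma expz_1B i : q != 0 -> q ^ (1 - i%:Z) = q / q ^+ i.
Proof. by move=> q0; rewrite expfzDr // expr1z -exprnN. Qed.

Lemma expz_1B2 i : q != 0 -> q ^ (1 - 2 * i%:Z) = q / q ^+ i ^+ 2.
Proof. by move=> q0; rewrite -PoszM expz_1B // mulnC exprM. Qed.

Lemma PqE i : q != 0 -> Pq d q i = (1 - q ^+ i) * (1 - q ^+ i / q ^+ d.+1).
Proof.
move=> q0; rewrite /Pq -addrA -opprD -[d%:Z + 1]/(d + 1)%:Z addn1.
by rewrite expfzDr // -exprnN.
Qed.

(** [R] is minus the middle coefficient of the quadratic in [q^i] inside [varphi], and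
    [theta_0 + theta_d = (1 + q^-d) * S], likewise for [Ss]. The Askey-Wilson scalars enter through
    equations, so that each family can supply its own simplified form of them. *)
Lemma AW_split (V : vectType F) (c : array F) (A As : 'End(V))
    (a b aa bb R rho rhos omega eta etas : F) :
  let S := b * q ^+ d.+1 + a in
  let Ss := bb * q ^+ d.+1 + aa in
  let Q := q ^+ d.+1 + 1 in
  let K := - ((q ^+ 2 - 1) ^+ 2 / q) in
  let Ks := (q - 1) ^+ 2 / q ^+ d.+1 in
  q != 0 -> corresponding_pair d c A As ->
  (forall i, theta c i = a * q ^ (- i%:Z) + b * q ^+ i.+1) ->
  (forall i, thetas c i = aa * q ^ (- i%:Z) + bb * q ^+ i.+1) ->
  (forall i, varphi c i = q ^ (1 - 2 * i%:Z) * Pq d q i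
     * (a * aa - R * q ^+ i + b * bb * q ^+ d.+1 * q ^+ i ^+ 2)) ->
  rho = a * b * K ->
  rhos = aa * bb * K ->
  omega = - Ks * (S * Ss + R * Q) ->
  eta = (q + 1) * Ks * (S * R + a * b * Ss * Q) ->
  etas = (q + 1) * Ks * (Ss * R + aa * bb * S * Q) ->
  AW A As (q + q^-1) 0 0 rho rhos omega eta etas.
Proof.
move=> S Ss Q K Ks q0 [e [be eA eAs]] th ths vphi -> -> -> -> ->.
have y0 : q ^+ d.+1 != 0 by rewrite expf_neq0.
have Ae := split_mx_action eA.
have vphi0 : varphi c 0 = 0.
  by rewrite vphi PqE // expr0 subrr mul0r mulr0 mul0r.
(* At [i = d.+1] it is the second factor of [P_i] that vanishes; at [i = 0] it was the first. *)
have Ase : forall j, As e`_j = thetas c j *: e`_j + varphi c j *: e`_j.-1.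
  apply: split_mxs_action => //.
  by rewrite vphi PqE // divff // subrr !mulr0 mul0r.
rewrite /S /Ss /Q /K /Ks.
(* Clears the integer exponents of [varphi], leaving only [q], [q ^+ i] and [q ^+ d.+1]. *)
have {}vphi i := etrans (vphi i) (congr1 (fun x => x * _)
  (congr2 *%R (expz_1B2 i q0) (PqE i q0))).
(* The identities hold for every nonzero [y] in place of [q ^+ d.+1]. *)
move: (q ^+ d.+1) y0 vphi => y y0 vphi.
have [AD AZ] : {morph A : u v / u + v} /\ scalable A.
  by split=> [u v | k u]; rewrite ?linearD ?linearZ.
have [AsD AsZ] : {morph As : u v / u + v} /\ scalable As.
  by split=> [u v | k u]; rewrite ?linearD ?linearZ.
rewrite /AW !scale0r !subr0 !add0r.
split; apply: (eq_on_basis be) => h n;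
  (have hD : {morph h : u v / u + v} by move=> u v; rewrite linearD);
  (have hN : {morph h : u / - u} by move=> u; rewrite linearN);
  (have hZ m : {morph h : u / m *: u >-> m * u}
     by move=> u; rewrite linearZ);
  rewrite !(add_lfunE, opp_lfunE, scale_lfunE, comp_lfunE, id_lfunE);
  (* [As] occurs at most twice in a product, so indices drop by at most two. For [n = 0] and [n = 1]
     the truncated terms die by [vphi0]; from [2] on, every predecessor computes. *)
  case: n => [|[|n]];
  do ?rewrite !(Ae, Ase, AD, AZ, AsD, AsZ, vphi0, scale0r, addr0) /=;
  rewrite !(hD, hZ, hN) !(th, ths, vphi) -!exprnN ?exprS ?expr0;
  by field; rewrite ?q0 ?y0 ?expf_neq0 ?oner_neq0.
Qed.

End GeneralFamily.

Theorem lemma5p2 (F : closedFieldType) (hchar : 2%N \notin [pchar F]) (d : nat)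
    (V : vectType F) (A As : 'End(V)) :
  (forall q s ss r : F,
     q != 0 -> s != 0 -> ss != 0 -> r != 0 ->
     admissible d (q_Racah d q s ss r) ->
     corresponding_pair d (q_Racah d q s ss r) A As ->
     let S := s * q ^+ d.+1 + 1 in
     let Ss := ss * q ^+ d.+1 + 1 in
     let R := r + s * ss * q ^+ d.+1 / r in
     let Q := q ^+ d.+1 + 1 in
     let K := - ((q ^+ 2 - 1) ^+ 2 / q) in
     let Ks := (q - 1) ^+ 2 / q ^+ d.+1 in
     AW A As (q + q^-1) 0 0 (s * K) (ss * K)
       (- Ks * (S * Ss + R * Q))
       ((q + 1) * Ks * (S * R + s * Ss * Q))
       ((q + 1) * Ks * (Ss * R + ss * S * Q))) /\
  (forall q ss r : F,
     q != 0 -> ss != 0 -> r != 0 ->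
     admissible d (q_Hahn d q ss r) ->
     corresponding_pair d (q_Hahn d q ss r) A As ->
     let Ss := ss * q ^+ d.+1 + 1 in
     let Q := q ^+ d.+1 + 1 in
     let K := - ((q ^+ 2 - 1) ^+ 2 / q) in
     let Ks := (q - 1) ^+ 2 / q ^+ d.+1 in
     AW A As (q + q^-1) 0 0 0 (ss * K)
       (- Ks * (Ss + r * Q))
       ((q + 1) * Ks * r)
       ((q + 1) * Ks * (Ss * r + ss * Q))) /\
  (forall q s r : F,
     q != 0 -> s != 0 -> r != 0 ->
     admissible d (dual_q_Hahn d q s r) ->
     corresponding_pair d (dual_q_Hahn d q s r) A As ->
     let S := s * q ^+ d.+1 + 1 in
     let Q := q ^+ d.+1 + 1 in
     let K := - ((q ^+ 2 - 1) ^+ 2 / q) in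
     let Ks := (q - 1) ^+ 2 / q ^+ d.+1 in
     AW A As (q + q^-1) 0 0 (s * K) 0
       (- Ks * (S + r * Q))
       ((q + 1) * Ks * (S * r + s * Q))
       ((q + 1) * Ks * r)) /\
  (forall q ss : F,
     q != 0 -> ss != 0 ->
     admissible d (q_Krawtchouk d q ss) ->
     corresponding_pair d (q_Krawtchouk d q ss) A As ->
     let Ss := ss * q ^+ d.+1 + 1 in
     let Q := q ^+ d.+1 + 1 in
     let K := - ((q ^+ 2 - 1) ^+ 2 / q) in
     let Ks := (q - 1) ^+ 2 / q ^+ d.+1 in
     AW A As (q + q^-1) 0 0 0 (ss * K)
       (- Ks * Ss)
       0
       ((q + 1) * Ks * ss * Q)) /\
  (forall q s : F,
     q != 0 -> s != 0 ->
     admissible d (dual_q_Krawtchouk d q s) ->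
     corresponding_pair d (dual_q_Krawtchouk d q s) A As ->
     let S := s * q ^+ d.+1 + 1 in
     let Q := q ^+ d.+1 + 1 in
     let K := - ((q ^+ 2 - 1) ^+ 2 / q) in
     let Ks := (q - 1) ^+ 2 / q ^+ d.+1 in
     AW A As (q + q^-1) 0 0 (s * K) 0
       (- Ks * S)
       ((q + 1) * Ks * s * Q)
       0) /\
  (forall q r : F,
     q != 0 -> r != 0 ->
     admissible d (quantum_q_Krawtchouk d q r) ->
     corresponding_pair d (quantum_q_Krawtchouk d q r) A As ->
     let Q := q ^+ d.+1 + 1 in
     let Ks := (q - 1) ^+ 2 / q ^+ d.+1 in
     AW A As (q + q^-1) 0 0 0 0
       (- Ks * (q ^+ d.+1 + r * Q))
       ((q + 1) * (q - 1) ^+ 2 * r)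
       ((q + 1) * Ks * r)) /\
  (forall q r : F,
     q != 0 -> r != 0 ->
     admissible d (affine_q_Krawtchouk d q r) ->
     corresponding_pair d (affine_q_Krawtchouk d q r) A As ->
     let Q := q ^+ d.+1 + 1 in
     let Ks := (q - 1) ^+ 2 / q ^+ d.+1 in
     AW A As (q + q^-1) 0 0 0 0
       (- Ks * (1 + r * Q))
       ((q + 1) * Ks * r)
       ((q + 1) * Ks * r)).
Proof.
pose simp :=
  (mul1r, mulr1, mul0r, mulr0, add0r, addr0, sub0r, subr0, oppr0).
split; last split; last split; last split; last split; last split.
- move=> q s ss r q0 _ _ r0 _ corr S Ss R Q K Ks.
  apply: (AW_split (a := 1) (b := s) (aa := 1) (bb := ss) (R := R) q0 corr)
    => [i|i|i|||||]; rewrite /= ?simp //.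
  (* With [x = q^i] and [y = q^(d+1)], this is [(1 - r x)(r - s ss y x) / r = 1 - R x + s ss y
     x^2]. *)
  by rewrite /R addn1 exprD; move: (q ^ _) (Pq _ _ _) => u v; field.
- move=> q ss r q0 _ _ _ corr Ss Q K Ks.
  apply: (AW_split (a := 1) (b := 0) (aa := 1) (bb := ss) (R := r) q0 corr)
    => [i|i|i|||||]; rewrite /= ?simp ?mulrA //.
- move=> q s r q0 _ _ _ corr S Q K Ks.
  apply: (AW_split (a := 1) (b := s) (aa := 1) (bb := 0) (R := r) q0 corr)
    => [i|i|i|||||]; rewrite /= ?simp ?mulrA //.
- move=> q ss q0 _ _ corr Ss Q K Ks.
  (* With [b = 0] and [R = 0] the quadratic factor of [varphi] reduces to [1]. *)
  apply: (AW_split (a := 1) (b := 0) (aa := 1) (bb := ss) (R := 0) q0 corr)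
    => [i|i|i|||||]; rewrite /= ?simp ?mulrA //.
- move=> q s q0 _ _ corr S Q K Ks.
  apply: (AW_split (a := 1) (b := s) (aa := 1) (bb := 0) (R := 0) q0 corr)
    => [i|i|i|||||]; rewrite /= ?simp ?mulrA //.
- move=> q r q0 _ _ corr Q Ks.
  (* Here [theta] is the increasing power of [q], so [a = 0] and only [- r q^i] survives in the
     quadratic. Moreover [S = q^(d+1)] cancels the denominator of [Ks] in [eta]. *)
  apply: (AW_split (a := 0) (b := 1) (aa := 1) (bb := 0) (R := r) q0 corr)
    => [i|i|i|||||]; rewrite /= ?simp //.
    by rewrite expz_1B // expz_1B2 //; field; rewrite ?expf_neq0.
  by rewrite /Ks; field; rewrite expf_neq0.
- move=> q r q0 _ _ corr Q Ks.
  apply: (AW_split (a := 1) (b := 0) (aa := 1) (bb := 0) (R := r) q0 corr)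
    => [i|i|i|||||]; rewrite /= ?simp //.
Qed.
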